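(* Let $q$ be a prime power, $m,n$ positive integers with $n\le m$, and let $\mathcal{C}\subseteq\mathbb{F}_q^{m\times n}$ be a nonzero $\mathbb{F}_q$-linear code with minimum rank distance $d$ whose dual code $\mathcal{C}^\perp$ is nonzero with minimum rank distance $d^\perp\ge 2$. Then the coefficient of $T^{n-d}$ in the formal power series $$Z_{\mathcal{C}}(T)\,\phi_n(T)=\frac{P_{\mathcal{C}}(T)\,\phi_n(T)}{(1-T)(1-q^mT)}\in\mathbb{Q}[x,y][[T]]$$ is $\dfrac{W_{\mathcal{C}}(x,y)-x^n}{q^m-1}$. In particular, writing $P_{\mathcal{C}}(T)=\sum_{i=0}^{n-d}p_iT^i$, one has $W_{\mathcal{C}}(x,y)=\sum_{i=0}^{n-d}p_iM_{n,d+i}(x,y)$, and $P_{\mathcal{C}}(T)$ is the unique polynomial of degree at most $n-d$ with this property.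
   Context: For $X\in\mathbb{F}_q^{m\times n}$, $X^\perp=\{y\in\mathbb{F}_q^n:Xy^T=0\}$; $\mathcal{C}^\perp=\{Y:\mathrm{Tr}(XY^T)=0\ \forall X\in\mathcal{C}\}$; $k=\dim_{\mathbb{F}_q}\mathcal{C}$; minimum rank distance = minimum rank of a nonzero element. $W_t(\mathcal{C})$ = number of elements of rank $t$, $W_{\mathcal{C}}(x,y)=\sum_{t=0}^nW_t(\mathcal{C})x^{n-t}y^t$. Gaussian binomial $\begin{bmatrix} n\\ r\end{bmatrix}$ counts $r$-dimensional subspaces of $\mathbb{F}_q^n$. For $U\le\mathbb{F}_q^n$, $\mathcal{C}_U=\{X\in\mathcal{C}:U\subseteq X^\perp\}$, $B_u(\mathcal{C})=\sum_{\dim U=n-u}(|\mathcal{C}_U|-1)$. Normalized binomial moments: $b_u(\mathcal{C})=B_{u+d}(\mathcal{C})/\begin{bmatrix} n\\ u+d\end{bmatrix}$ for $0\le u\le n-d$, $b_u(\mathcal{C})=0$ for $u<0$, $b_u(\mathcal{C})=q^{k-m(n-u-d)}-1$ for $u>n-d$. Zeta function: $Z_{\mathcal{C}}(T)=(q^m-1)^{-1}\sum_{u\ge0}b_u(\mathcal{C})T^u$. With $p_u=(q^m-1)^{-1}(b_u-(q^m+1)b_{u-1}+q^mb_{u-2})$, the zeta polynomial is $P_{\mathcal{C}}(T)=\sum_{u=0}^{n-d-d^\perp+2}p_uT^u$, and $Z_{\mathcal{C}}(T)=P_{\mathcal{C}}(T)/((1-T)(1-q^mT))$. For $1\le \delta\le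 n$, the MRD weight enumerator is $$M_{n,\delta}(x,y)=x^n+\sum_{t=\delta}^n\sum_{i=\delta}^t(-1)^{t-i}q^{\binom{t-i}{2}}\begin{bmatrix} n\\ t\end{bmatrix}\begin{bmatrix} t\\ i\end{bmatrix}(q^{m(i-\delta+1)}-1)x^{n-t}y^t.$$ For $0\le i\le n$ let $\phi_{n,n-i}(x,y)=\sum_{t=i}^n(-1)^{t-i}q^{\binom{t-i}{2}}\begin{bmatrix} n\\ t\end{bmatrix}\begin{bmatrix} t\\ i\end{bmatrix}x^{n-t}y^t$ (for $1\le i\le n-2$ this equals $(q^m-1)^{-1}(M_{n,i}-(q^m+1)M_{n,i+1}+q^mM_{n,i+2})$), and $\phi_n(T)=\sum_{j=0}^n\phi_{n,j}(x,y)T^j$. *)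

(* Defs.v *)
From HB Require Import structures.
From mathcomp Require Import all_boot all_order all_algebra.
From mathcomp Require Import mpoly.

Set Implicit Arguments.
Unset Strict Implicit.
Unset Printing Implicit Defensive.

Import Order.TTheory GRing.Theory Num.Theory.
Import VectorInternalTheory.
Local Open Scope ring_scope.

(* Over a finite field a vector space has finitely many subspaces, so one can
   sum over them. *)
HB.instance Definition _ (F : finFieldType) (vT : vectType F) :=
  [Countable of {vspace vT} by <:].
HB.instance Definition _ (F : finFieldType) (vT : vectType F) :=
  [Finite of {vspace vT} by <:].

(* A formal power series is its sequence of coefficients; two series are equal
   when their coefficients are (=1). *)
Definition fps (R : Type) := nat -> R.

Section FormalPowerSeries.
Variable R : comUnitRingType.
Implicit Types f g : fps R.

Definition fps_of_poly (p : {poly R}) : fps R := fun k => p`_k.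

Definition fps_mul f g : fps R := fun k => \sum_(i < k.+1) f i * g (k - i)%N.

(* The coefficients g_0, ..., g_(k-1) of 1/f, computed from
   f_0 * g_k = - \sum_(i < k) f_(k-i) * g_i. *)
Fixpoint fps_inv_seq f (k : nat) : seq R :=
  if k is k'.+1 then
    let s := fps_inv_seq f k' in
    rcons s ((f 0%N)^-1 * ((k' == 0%N)%:R - \sum_(i < k') f (k' - i)%N * s`_i))
  else [::].

Definition fps_inv f : fps R := fun k => (fps_inv_seq f k.+1)`_k.

Definition fps_div f g : fps R := fps_mul f (fps_inv g).

Lemma size_fps_inv_seq f k : size (fps_inv_seq f k) = k.
Proof. by elim: k => //= k IHk; rewrite size_rcons IHk. Qed.

Lemma nth_fps_inv_seq f k i : (i < k)%N -> (fps_inv_seq f k)`_i = fps_inv f i.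
Proof.
elim: k => // k IHk; rewrite ltnS leq_eqVlt => /orP[/eqP -> //|ltik] /=.
by rewrite nth_rcons size_fps_inv_seq ltik IHk.
Qed.

Lemma fps_mulV f : f 0%N \is a GRing.unit ->
  fps_mul f (fps_inv f) =1 fps_of_poly 1.
Proof.
move=> Uf k; rewrite /fps_mul /fps_of_poly coef1 big_ord_recl subn0.
rewrite {1}/fps_inv /= nth_rcons size_fps_inv_seq ltnn eqxx mulVKr //.
rewrite -[RHS]addr0 -addrA; congr (_ + _); apply/eqP; rewrite addrC subr_eq0.
apply/eqP; rewrite [LHS](reindex_inj rev_ord_inj) /=; apply: eq_bigr => i _.
rewrite nth_fps_inv_seq // /bump /= add1n -subSn // subSS.
by rewrite subKn // ltnW.
Qed.

End FormalPowerSeries.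

Section RankMetricCodes.
Variables (F : finFieldType) (m n : nat).
Local Notation q := #|F|.
Local Notation qm := ((q ^ m)%:R : rat).
Implicit Types (C : {vspace 'M[F]_(m, n)}) (X Y : 'M[F]_(m, n)).

Definition trace_form X : {linear 'M[F]_(m, n) -> F^o} :=
  mxtrace \o (mulmx X \o trmx).

Definition dual_code C : {vspace 'M[F]_(m, n)} :=
  (\bigcap_(X in C) lker (linfun (trace_form X)))%VS.

Lemma dual_codeP C Y :
  reflect (forall X, X \in C -> \tr (X *m Y^T) = 0) (Y \in dual_code C).
Proof.
rewrite memvE; apply: (iffP subv_bigcapP) => [dY X CX | dY X CX].
  by have := dY X CX; rewrite -memvE memv_ker lfunE /= => /eqP.
by rewrite -memvE memv_ker lfunE /= dY.
Qed.

(* The default n only matters for the zero code: ranks are at most n. *)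
Definition min_rank_dist C : nat :=
  \big[minn/n]_(X : 'M[F]_(m, n) | (X \in C) && (X != 0)) \rank X.

Lemma min_rank_distP C d : C != 0%VS ->
  reflect ((exists X, [/\ X \in C, X != 0 & \rank X = d]) /\
           (forall X, X \in C -> X != 0 -> (d <= \rank X)%N))
          (min_rank_dist C == d).
Proof.
move=> C_neq0; rewrite /min_rank_dist -minEnat.
pose P X := (X \in C) && (X != 0).
have PX0: P (vpick C) by rewrite /P memv_pick vpick0.
rewrite (@bigmin_eq_arg _ _ _ n _ P _ PX0); last by move=> X _; apply: rank_leq_col.
case: arg_minP => //= X /andP[CX X_neq0] minX.
apply: (iffP eqP) => [<- | [[Y [CY Y_neq0 <-]] minY]].
  by split=> [|Y CY Y_neq0]; [exists X | apply: minX; apply/andP].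
by apply/eqP; rewrite eqn_leq minY // andbT; apply: minX; apply/andP.
Qed.

Definition rank_weight C (t : nat) : nat :=
  #|[set X : 'M[F]_(m, n) | (X \in C) && (\rank X == t)]|.

Definition xvar : {mpoly rat[2]} := 'X_(0 : 'I_2).
Definition yvar : {mpoly rat[2]} := 'X_(1 : 'I_2).

Definition weight_enum C : {mpoly rat[2]} :=
  \sum_(0 <= t < n.+1) (rank_weight C t)%:R *: (xvar ^+ (n - t) * yvar ^+ t).

Definition gauss_binom (a r : nat) : nat :=
  #|[set U : {vspace 'rV[F]_a} | \dim U == r]|.

Definition mx_perp X : {set 'rV[F]_n} := [set y | X *m y^T == 0].

Definition shortened C (U : {vspace 'rV[F]_n}) : {set 'M[F]_(m, n)} :=
  [set X | (X \in C) && (U \subset mx_perp X)].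

Definition binom_moment C (u : nat) : rat :=
  \sum_(U : {vspace 'rV[F]_n} | (\dim U == n - u)%N)
    (#|shortened C U|%:R - 1).

Definition norm_binom_moment C (u : int) : rat :=
  let d := min_rank_dist C in
  match u with
  | Negz _ => 0
  | Posz u =>
    if (u + d <= n)%N
    then binom_moment C (u + d) / (gauss_binom n (u + d))%:R
    else q%:R ^ ((\dim C)%:Z - m%:Z * (n%:Z - u%:Z - d%:Z)) - 1
  end.

Definition zeta_series C : fps rat :=
  fun u => (qm - 1)^-1 * norm_binom_moment C u%:Z.

Definition zeta_coef C (u : nat) : rat :=
  (qm - 1)^-1 * (norm_binom_moment C u%:Z
                 - (qm + 1) * norm_binom_moment C (u%:Z - 1)
                 + qm * norm_binom_moment C (u%:Z - 2)).

(* Degrees run up to n - d - d' + 2, with d, d' the minimum distances of C and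
   its dual; the bound is arranged to avoid truncated subtraction. *)
Definition zeta_poly C : {poly rat} :=
  \poly_(u < n + 3 - (min_rank_dist C + min_rank_dist (dual_code C)))
    zeta_coef C u.

Definition mrd_enum (delta : nat) : {mpoly rat[2]} :=
  xvar ^+ n +
  \sum_(delta <= t < n.+1) \sum_(delta <= i < t.+1)
    ((-1) ^+ (t - i) * (q ^ 'C(t - i, 2))%:R
     * (gauss_binom n t)%:R * (gauss_binom t i)%:R
     * ((q ^ (m * (i - delta + 1)))%:R - 1))
    *: (xvar ^+ (n - t) * yvar ^+ t).

(* phi j is \phi_{n,j}, that is \phi_{n,n-i} with i = n - j (for j <= n). *)
Definition phi (j : nat) : {mpoly rat[2]} :=
  let i := (n - j)%N in
  \sum_(i <= t < n.+1)
    ((-1) ^+ (t - i) * (q ^ 'C(t - i, 2))%:R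
     * (gauss_binom n t)%:R * (gauss_binom t i)%:R)
    *: (xvar ^+ (n - t) * yvar ^+ t).

Definition phi_poly : {poly {mpoly rat[2]}} := \poly_(j < n.+1) phi j.

Definition zeta_denom : {poly {mpoly rat[2]}} :=
  (1 - 'X) * (1 - (q ^ m)%:R *: 'X).

End RankMetricCodes.

(* Main.v *)
(** Let [B_w] be the binomial moment of [C]. A nonzero word [X] of rank [r] in
    [C] is counted in [B_w] once for each subspace of dimension [n - w] of
    its kernel, and q-binomial inversion shows that the sum over [w] of
    [[n-r; n-w] / [n; w] * phi_{n,n-w}] is the monomial [x^(n-r) y^r]. Hence
    [W_C - x^n] is the sum of [b_u * phi_{n,n-d-u}], which is the
    coefficient of [T^(n-d)]. Shortening at [U] of dimension [< d'] is as
    small as dimensions allow, because a functional on the matrices that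
    annihilates the restriction of [C] to [U] yields a dual word of rank [<=
    dim U]. So [b_u = q^(k-m(n-u-d)) - 1] as soon as [n - u - d < d'], and
    there the recurrence with roots [1] and [q^m] annihilates [b]: this
    gives the degree of [P]. The expansion in MRD enumerators is the same
    formula, with [b_u] recovered from the [p_i] through [1/((1-T)(1-q^m
    T))], and [P(1) = 1] accounting for [x^n]. Uniqueness holds because the
    MRD enumerators are triangular in the powers of [y]. *)

Require Import Defs.
From HB Require Import structures.
From mathcomp Require Import all_boot all_order all_algebra finfield mxabelem.
From mathcomp Require Import mpoly ring zify.

Set Implicit Arguments.
Unset Strict Implicit.
Unset Printing Implicit Defensive.

Import Order.TTheory GRing.Theory Num.Theory.
Local Open Scope ring_scope.

(** * Counting subspaces by counting free tuples *)

Definition free_tuples (F : finFieldType) n (V : {vspace 'rV[F]_n}) r :=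
  [set X : r.-tuple 'rV[F]_n | free X && (<<X>> <= V)%VS].

(** Prepending [v] to a free [X] of length i keeps it free exactly when [v] lies outside the span,
    which excludes q^i vectors. If r > dim V, the factor at i = dim V is zero. *)
Lemma card_free_tuples (F : finFieldType) n (V : {vspace 'rV[F]_n}) r :
  #|free_tuples V r| = (\prod_(i < r) (#|F| ^ \dim V - #|F| ^ i))%N.
Proof.
elim: r => [|r IHr].
  rewrite big_ord0; apply/eqP/cards1P; exists [tuple]; apply/setP => X.
  by rewrite !inE (tuple0 X) eqxx nil_free span_nil sub0v.
pose h (p : r.-tuple 'rV[F]_n * 'rV[F]_n) := cons_tuple p.2 p.1.
have bij_h : {on [pred X in free_tuples V r.+1], bijective h}.
  exists (fun X : r.+1.-tuple _ => (behead_tuple X, thead X)).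
    by move=> [X v] _; congr (_, _); apply: val_inj.
  by move=> X _; apply: val_inj; case/tupleP: X => v X.
rewrite big_ord_recr /= -IHr -[LHS]sum1_card (reindex h) //=.
rewrite (eq_bigl (fun p => (p.1 \in free_tuples V r)
                           && (p.2 \in [predD V & <<p.1>>%VS]))); last first.
  case=> X v; rewrite !inE /= free_cons span_cons subv_add -memvE.
  by case: (v \in V); case: (v \in _); case: free; case: (_ <= _)%VS.
rewrite -(pair_big_dep (fun X : r.-tuple _ => X \in free_tuples V r)
  (fun X v => v \in [predD V & <<X>>%VS]) (fun _ _ => 1%N)) /=.
rewrite -sum_nat_const; apply: eq_bigr => X; rewrite inE => /andP[freeX sXV].
rewrite sum1_card -card_vspace -[in RHS](size_tuple X).
rewrite -(eqP freeX) -card_vspace.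
rewrite -(cardID [pred v in <<X>>%VS] V).
have ->: #|[predI V & [pred v in <<X>>%VS]]| = #|<<X>>%VS|.
  by apply: eq_card => v; rewrite !inE andb_idl // => /(subvP sXV).
by rewrite addKn; apply: eq_card => v; rewrite !inE.
Qed.

(** The free r-tuples of [V] are partitioned by their span, and each U of dimension r is spanned by
    precisely the free r-tuples inside U. *)
Lemma card_subspaces (F : finFieldType) n (V : {vspace 'rV[F]_n}) r :
  (#|[set U : {vspace 'rV[F]_n} | (U <= V)%VS && (\dim U == r)]|
     * \prod_(i < r) (#|F| ^ r - #|F| ^ i)
   = \prod_(i < r) (#|F| ^ \dim V - #|F| ^ i))%N.
Proof.
rewrite -card_free_tuples -[RHS]sum1_card.
rewrite (partition_big (fun X : r.-tuple _ => <<X>>%VS)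
  (mem [set U : {vspace 'rV[F]_n} | (U <= V)%VS && (\dim U == r)])) /=; last first.
  by move=> X; rewrite !inE => /andP[/eqP-> ->]; rewrite size_tuple eqxx.
rewrite -sum_nat_const; apply: eq_bigr => U; rewrite inE => /andP[sUV /eqP dimU].
have ->: (\prod_(i < r) (#|F| ^ r - #|F| ^ i) = #|free_tuples U r|)%N.
  by rewrite card_free_tuples dimU.
rewrite -[LHS]sum1_card; apply: eq_bigl => X.
rewrite !inE -andbA; case freeX: (free X) => //=.
rewrite eqEdim dimU (eqP freeX) size_tuple leqnn andbT.
by rewrite andb_idl // => /subv_trans->.
Qed.

Lemma gauss_binom_prod (F : finFieldType) a r :
  (gauss_binom F a r * \prod_(i < r) (#|F| ^ r - #|F| ^ i)
   = \prod_(i < r) (#|F| ^ a - #|F| ^ i))%N.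
Proof.
have := card_subspaces {: 'rV[F]_a} r; rewrite dimvf /dim /= mul1n => <-.
by congr (#|pred_of_set _| * _)%N; apply/setP => U; rewrite !inE subvf.
Qed.

Lemma card_finField_gt1 (F : finFieldType) : (1 < #|F|)%N.
Proof. exact: finNzRing_gt1. Qed.

Lemma card_subspaces_dim (F : finFieldType) n (V : {vspace 'rV[F]_n}) r :
  #|[set U : {vspace 'rV[F]_n} | (U <= V)%VS && (\dim U == r)]|
  = gauss_binom F (\dim V) r.
Proof.
have prod_gt0: (0 < \prod_(i < r) (#|F| ^ r - #|F| ^ i))%N.
  by apply: prodn_gt0 => i; rewrite subn_gt0 ltn_exp2l ?card_finField_gt1.
by apply/eqP; rewrite -(eqn_pmul2r prod_gt0) card_subspaces gauss_binom_prod.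
Qed.

(** * Gaussian binomials through q-factorials *)

(** This is the q-factorial times (q-1)^k; these powers cancel in Gaussian binomials. *)
Definition qfact (R : pzRingType) (q : R) k := \prod_(i < k) (q ^+ i.+1 - 1).

Lemma qfactS (R : pzRingType) (q : R) k :
  qfact q k.+1 = qfact q k * (q ^+ k.+1 - 1).
Proof. by rewrite /qfact big_ord_recr. Qed.

Lemma qfact_neq0 (R : numDomainType) (q : nat) k :
  (1 < q)%N -> qfact (q%:R : R) k != 0.
Proof.
move=> q_gt1; apply/prodf_neq0 => i _; rewrite subr_eq0 -natrX pnatr_eq1.
by rewrite -(expn0 q) eqn_exp2l.
Qed.

(** Since q^a - q^i = q^i (q^(a-i) - 1), the powers q^i gather into q^C(r,2) and the other factors
    are the top r of [qfact q%:R a]. *)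
Lemma prod_expB_qfact (R : numDomainType) q a r : (0 < q)%N -> (r <= a)%N ->
  (\prod_(i < r) (q ^ a - q ^ i))%:R * qfact (q%:R : R) (a - r)
  = q%:R ^+ 'C(r, 2) * qfact q%:R a.
Proof.
move=> q_gt0; elim: r => [|r IHr] lt_ra; first by rewrite big_ord0 subn0 !mul1r.
rewrite big_ord_recr /= natrM natrB ?leq_pexp2l // ?(ltnW lt_ra) //.
have := IHr (ltnW lt_ra); rewrite -(subnSK lt_ra) qfactS (subnSK lt_ra).
rewrite binS bin1 addnC exprD -!mulrA.
move=> <-.
rewrite -[in (q ^ a)%N](subnK (ltnW lt_ra)) expnD natrM !natrX.
ring.
Qed.

Lemma gauss_binomE (F : finFieldType) a r : (r <= a)%N ->
  (gauss_binom F a r)%:R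
  = qfact #|F|%:R a / (qfact #|F|%:R r * qfact #|F|%:R (a - r)) :> rat.
Proof.
move=> le_ra; have q_gt1 := card_finField_gt1 F; have q_gt0 := ltnW q_gt1.
have nz k := qfact_neq0 rat k q_gt1.
apply: (mulIf (mulf_neq0 (nz r) (nz (a - r)%N))); rewrite divfK ?mulf_neq0 //.
have := congr1 (fun k => k%:R : rat) (gauss_binom_prod F a r).
rewrite natrM.
have := prod_expB_qfact rat q_gt0 (leqnn r).
have := prod_expB_qfact rat q_gt0 le_ra.
rewrite subnn [qfact _ 0]big_ord0 mulr1 => Ea -> Er.
(* The products at [a] and at [r] share the factor q^C(r,2), which cancels. *)
apply: (mulfI (_ : #|F|%:R ^+ 'C(r, 2) != 0)).
  by rewrite expf_neq0 // pnatr_eq0 -lt0n.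
rewrite -Ea -Er; ring.
Qed.

Lemma gauss_binom_small (F : finFieldType) a r :
  (a < r)%N -> gauss_binom F a r = 0%N.
Proof.
move=> lt_ar; apply/eqP; rewrite cards_eq0; apply/eqP/setP => U; rewrite !inE.
apply: contraTF lt_ar => /eqP <-; rewrite -leqNgt.
by have := dimvS (subvf U); rewrite dimvf /dim /= mul1n.
Qed.


Lemma gauss_binom0 (F : finFieldType) a : gauss_binom F a 0 = 1%N.
Proof. by have := gauss_binom_prod F a 0; rewrite !big_ord0 muln1. Qed.

Lemma gauss_binom_full (F : finFieldType) a : gauss_binom F a a = 1%N.
Proof.
apply/eqP; rewrite -(eqr_nat rat) gauss_binomE // subnn [qfact _ 0]big_ord0.
by rewrite mulr1 divff // qfact_neq0 // card_finField_gt1.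
Qed.

Lemma gauss_binom_sym (F : finFieldType) a r : (r <= a)%N ->
  gauss_binom F a (a - r) = gauss_binom F a r.
Proof.
move=> le_ra; apply/eqP; rewrite -(eqr_nat rat) !gauss_binomE ?leq_subr //.
by rewrite subKn // [X in _ / X]mulrC.
Qed.

Lemma gauss_binom_gt0 (F : finFieldType) a r :
  (r <= a)%N -> (0 < gauss_binom F a r)%N.
Proof.
move=> le_ra; rewrite lt0n -(pnatr_eq0 rat) gauss_binomE //.
by rewrite !(mulf_neq0, invr_neq0) ?qfact_neq0 ?card_finField_gt1.
Qed.

(** The factorial formula settles r < a; both sides are 1 at r = a and 0 for r > a. *)
Lemma gauss_binomS (F : finFieldType) a r :
  gauss_binom F a.+1 r.+1
  = (gauss_binom F a r + #|F| ^ r.+1 * gauss_binom F a r.+1)%N.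
Proof.
case: (ltngtP a r) => [lt_ar|lt_ra|->].
- by rewrite !gauss_binom_small ?muln0 // ltnS ltnW.
- apply/eqP; rewrite -(eqr_nat rat) natrD natrM natrX.
  rewrite (gauss_binomE F (ltnW lt_ra : r.+1 <= a.+1)%N).
  rewrite (gauss_binomE F (ltnW lt_ra)) (gauss_binomE F lt_ra).
  have nz k := qfact_neq0 rat k (card_finField_gt1 F).
  rewrite subSS -(subnSK lt_ra) !qfactS; have := nz a.+1; have := nz r.+1.
  have := nz (a - r.+1).+1; rewrite !qfactS !mulf_eq0 !negb_or.
  move=> /andP[nz1 nz2] /andP[nz3 nz4] /andP[nz5 nz6].
  have: #|F|%:R ^+ a.+1 = #|F|%:R ^+ (a - r.+1).+1 * #|F|%:R ^+ r.+1 :> rat.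
    by rewrite -exprD; congr (_ ^+ _); lia.
  move=> ->; apply/eqP; field.
  by rewrite nz1 nz2 nz3 nz4.
by rewrite !gauss_binom_full [gauss_binom F r r.+1]gauss_binom_small ?muln0.
Qed.

(* The truncated sum, unlike the full one, lends itself to induction. *)
Lemma gauss_binom_altsum_trunc (F : finFieldType) (R : comPzRingType) a k :
  \sum_(j < k.+1) (-1) ^+ j * (#|F| ^ 'C(j, 2))%:R * (gauss_binom F a.+1 j)%:R
  = (-1) ^+ k * (#|F| ^ 'C(k.+1, 2))%:R * (gauss_binom F a k)%:R :> R.
Proof.
elim: k => [|k IHk]; first by rewrite big_ord1 !gauss_binom0.
rewrite big_ord_recr /= {}IHk gauss_binomS natrD natrM [in RHS]binS bin1.
by rewrite expnD natrM exprS; ring.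
Qed.

(** This is the orthogonality behind q-binomial inversion. For a positive top index the truncated
    sum is taken up to that index, where its closed form contains a vanishing Gaussian binomial. *)
Lemma gauss_binom_altsum (F : finFieldType) (R : comPzRingType) a :
  \sum_(j < a.+1) (-1) ^+ j * (#|F| ^ 'C(j, 2))%:R * (gauss_binom F a j)%:R
  = (a == 0%N)%:R :> R.
Proof.
case: a => [|a]; first by rewrite big_ord1 gauss_binom0 !mulr1.
by rewrite gauss_binom_altsum_trunc gauss_binom_small ?mulr0.
Qed.

(** On the right only one factor depends on w, so the alternating sum over w can be evaluated. *)
Lemma gauss_binom_trinomial (F : finFieldType) n t w r :
    (r <= w)%N -> (w <= t)%N -> (t <= n)%N ->
  (gauss_binom F (n - r) (n - w))%:R / (gauss_binom F n w)%:R
    * ((gauss_binom F n t)%:R * (gauss_binom F t w)%:R)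
  = (gauss_binom F (n - r) (t - r))%:R * (gauss_binom F (t - r) (t - w))%:R :> rat.
Proof.
move=> le_rw le_wt le_tn; have nz k := qfact_neq0 rat k (card_finField_gt1 F).
rewrite !gauss_binomE; [|lia..].
have ->: (n - r - (n - w) = w - r)%N by lia.
have ->: (n - r - (t - r) = n - t)%N by lia.
have ->: (t - r - (t - w) = w - r)%N by lia.
by field; rewrite !nz.
Qed.

(** * Monomials as combinations of the phi polynomials *)

(** A range of t independent of w allows sums to be exchanged. The truncated [t - w] is harmless, as
    [t; w] = 0 for t < w. *)
Lemma phiE (F : finFieldType) n w : (w <= n)%N ->
  phi F n (n - w) = \sum_(t < n.+1)
    ((-1) ^+ (t - w) * (#|F| ^ 'C(t - w, 2))%:R
     * (gauss_binom F n t)%:R * (gauss_binom F t w)%:R)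
    *: (xvar ^+ (n - t) * yvar ^+ t).
Proof.
move=> le_wn; rewrite /phi subKn // big_geq_mkord big_mkcond /=.
apply: eq_bigr => t _; case: leqP => // lt_tw.
by rewrite [gauss_binom F t w]gauss_binom_small // mulr0 scale0r.
Qed.

(** After exchanging the sums, the coefficient of x^(n-t) y^t is [n-r; t-r] times an alternating sum
    of the [t-r; j], which vanishes unless t = r. *)
Lemma monom_phi (F : finFieldType) n r : (r <= n)%N ->
  \sum_(w < n.+1)
    ((gauss_binom F (n - r) (n - w))%:R / (gauss_binom F n w)%:R)
    *: phi F n (n - w)
  = xvar ^+ (n - r) * yvar ^+ r.
Proof.
move=> le_rn; under eq_bigr => w _ do rewrite phiE -1?ltnS // scaler_sumr.
rewrite exchange_big /=; under eq_bigr => t _ do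
  under eq_bigr => w _ do rewrite scalerA.
under eq_bigr => t _ do rewrite -scaler_suml.
suff coefE (t : 'I_n.+1) : \sum_(w < n.+1)
    (gauss_binom F (n - r) (n - w))%:R / (gauss_binom F n w)%:R
    * ((-1) ^+ (t - w) * (#|F| ^ 'C(t - w, 2))%:R
       * (gauss_binom F n t)%:R * (gauss_binom F t w)%:R)
    = (t == Ordinal (le_rn : (r < n.+1)%N))%:R :> rat.
  under eq_bigr => t _ do rewrite coefE.
  rewrite (bigD1 (Ordinal (le_rn : (r < n.+1)%N))) //= eqxx scale1r big1 ?addr0 //.
  by move=> t /negPf->; rewrite scale0r.
rewrite -val_eqE /=; case: t => t /=; rewrite ltnS => le_tn.
(* Terms with w < r or w > t contain a vanishing Gaussian binomial; for t < r these are all the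
   terms. *)
have [lt_tr|le_rt] := ltnP t r.
  rewrite ltn_eqF // big1 // => w _; have [lt_wr|le_rw] := ltnP w r.
    by rewrite gauss_binom_small ?mul0r //; lia.
  by rewrite [gauss_binom F t w]gauss_binom_small ?mulr0 //; lia.
pose f w := (gauss_binom F (n - r) (n - w))%:R / (gauss_binom F n w)%:R
    * ((-1) ^+ (t - w) * (#|F| ^ 'C(t - w, 2))%:R
       * (gauss_binom F n t)%:R * (gauss_binom F t w)%:R) : rat.
rewrite -(big_mkord xpredT f) /f.
rewrite (big_cat_nat (leq0n r)) ?leqW //= big_nat big1 ?add0r; last first.
  by move=> w /= lt_wr; rewrite gauss_binom_small ?mul0r //; lia.
rewrite (big_cat_nat (leqW le_rt)) //= addrC big_nat big1 ?add0r; last first.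
  move=> w /= /andP[lt_tw _].
  by rewrite [gauss_binom F t w]gauss_binom_small ?mulr0.
(* With j = t - w the range r <= w <= t becomes 0 <= j <= t - r. *)
rewrite big_nat_rev -{1}[r]add0n big_addn big_mkord subSn //.
transitivity ((gauss_binom F (n - r) (t - r))%:R * \sum_(j < (t - r).+1)
    (-1) ^+ j * (#|F| ^ 'C(j, 2))%:R * (gauss_binom F (t - r) j)%:R : rat).
  rewrite mulr_sumr; apply: eq_bigr => j _; have := ltn_ord j; rewrite ltnS => le_j.
  have ->: (r + t.+1 - (j + r).+1 = t - j)%N by lia.
  have le_rtj: (r <= t - j)%N by lia.
  have := gauss_binom_trinomial F le_rtj (leq_subr j t) le_tn.
  have -> : (t - (t - j) = j)%N by lia.
  move=> tri; transitivity ((-1) ^+ j * (#|F| ^ 'C(j, 2))%:R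
    * ((gauss_binom F (n - r) (t - r))%:R * (gauss_binom F (t - r) j)%:R) : rat).
    by rewrite -tri; ring.
  by ring.
rewrite gauss_binom_altsum subn_eq0; case: eqVneq => [->|neq_tr].
  by rewrite leqnn subnn gauss_binom0 mul1r.
by rewrite leqNgt ltn_neqAle eq_sym neq_tr le_rt mulr0.
Qed.

(** * Minimum distance, kernels and shortening *)

Lemma min_rank_dist_le (F : finFieldType) m n (C : {vspace 'M[F]_(m, n)}) X :
  X \in C -> X != 0 -> (min_rank_dist C <= \rank X)%N.
Proof.
move=> CX X_neq0; rewrite /min_rank_dist -minEnat.
by rewrite -leEnat; apply: bigmin_le_cond; rewrite CX.
Qed.

Lemma min_rank_dist_le_col (F : finFieldType) m n (C : {vspace 'M[F]_(m, n)}) :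
  (min_rank_dist C <= n)%N.
Proof. by rewrite /min_rank_dist -minEnat -leEnat bigmin_le_id. Qed.

Lemma min_rank_dist_gt0 (F : finFieldType) m n (C : {vspace 'M[F]_(m, n)}) :
  (0 < n)%N -> (0 < min_rank_dist C)%N.
Proof.
move=> n_gt0; rewrite /min_rank_dist; elim/big_ind: _ => //.
  by move=> x y x_gt0 y_gt0; rewrite leq_min x_gt0.
by move=> X /andP[_]; rewrite -mxrank_eq0 lt0n.
Qed.

Lemma mx_perp_lker (F : finFieldType) m n (X : 'M[F]_(m, n))
    (U : {vspace 'rV[F]_n}) :
  (U \subset mx_perp X) = (U <= lker (linfun (mulmxr X^T)))%VS.
Proof.
have memE y : (y \in mx_perp X) = (y \in lker (linfun (mulmxr X^T))).
  rewrite inE memv_ker lfunE /= -(inj_eq trmx_inj) trmx_mul trmxK.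
  by rewrite trmx0.
apply/subsetP/subvP => sUX y Uy; first by rewrite -memE sUX.
by rewrite memE sUX.
Qed.

Lemma dim_lker_mulmxr (F : finFieldType) m n (A : 'M[F]_(n, m)) :
  \dim (lker (linfun (mulmxr A : 'rV[F]_n -> 'rV[F]_m))) = (n - \rank A)%N.
Proof.
apply/eqP; rewrite -(eqn_exp2l _ _ (card_finField_gt1 F)) -card_vspace.
rewrite -mxrank_ker -card_rowg; apply/eqP/eq_card => y.
by rewrite inE memv_ker lfunE /= sub_kermx.
Qed.

Lemma proper_dual_code (F : finFieldType) m n (D : {vspace 'M[F]_(m, n)}) :
  D != fullv -> exists2 Z, Z != 0 & Z \in dual_code D.
Proof.
move=> D_proper; have /subvPn[X0 _ DX0]: ~~ (fullv <= D)%VS.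
  by apply: contra D_proper => sD; rewrite eqEsubv subvf.
(* An entry of the complementary projection is a functional that vanishes on D
   but not at X0; Z represents it for the trace form. *)
pose g := (\1 - projv D)%VF.
have gE X : g X = X - projv D X by rewrite !lfunE /= opp_lfunE lfunE.
have /matrix0Pn[i [j gX0]] : g X0 != 0.
  by apply: contra DX0; rewrite gE subr_eq0 => /eqP->; apply: memv_proj.
pose Z := \matrix_(a, b) g (delta_mx a b) i j.
have trZ X : \tr (X *m Z^T) = g X i j.
  rewrite [in RHS](matrix_sum_delta X) linear_sum summxE; apply: eq_bigr => a _.
  rewrite mxE linear_sum summxE; apply: eq_bigr => b _.
  by rewrite linearZ !mxE.
exists Z.
  by apply: contraNneq gX0 => Z0; rewrite -trZ Z0 trmx0 mulmx0 linear0.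
by apply/dual_codeP => X DX; rewrite trZ gE projv_id // subrr mxE.
Qed.

Definition basis_mx (F : finFieldType) n (U : {vspace 'rV[F]_n}) :
  'M[F]_(\dim U, n) := \matrix_i (vbasis U)`_i.

Lemma row_free_basis_mx (F : finFieldType) n (U : {vspace 'rV[F]_n}) :
  row_free (basis_mx U).
Proof.
apply: inj_row_free => v vU0; apply/rowP => i; rewrite mxE.
have /freeP := basis_free (vbasisP U); apply.
rewrite -[RHS]vU0 mulmx_sum_row; apply: eq_bigr => j _.
by rewrite rowK.
Qed.

Lemma mx_perp_basis_mx (F : finFieldType) m n (X : 'M[F]_(m, n))
    (U : {vspace 'rV[F]_n}) :
  (U \subset mx_perp X) = (X *m (basis_mx U)^T == 0).
Proof.
rewrite mx_perp_lker -(inj_eq trmx_inj) trmx_mul trmxK trmx0.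
rewrite -[in LHS](span_basis (vbasisP U)).
apply/span_subvP/eqP => [sUX | UX0 y].
  apply/row_matrixP => i; rewrite row_mul rowK row0.
  have: (vbasis U)`_i \in vbasis U by rewrite memt_nth.
  by move/sUX; rewrite memv_ker lfunE /= => /eqP.
case/tnthP => i ->; rewrite memv_ker lfunE /= (tnth_nth 0).
by rewrite -(rowK (fun i : 'I_(\dim U) => (vbasis U)`_i) i) -row_mul UX0 row0.
Qed.

(** Rank-nullity for the restriction of [C] to [U]: its kernel is the shortened code, and the bound
    on dim U makes it onto. *)
Lemma card_shortened_dual (F : finFieldType) m n (C : {vspace 'M[F]_(m, n)})
    (U : {vspace 'rV[F]_n}) :
  (\dim U < min_rank_dist (dual_code C))%N ->
  (#|shortened C U| * #|F| ^ (m * \dim U) = #|F| ^ \dim C)%N.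
Proof.
move=> lt_U_d'; set A := basis_mx U.
pose f : 'Hom('M[F]_(m, n), 'M[F]_(m, \dim U)) := linfun (mulmxr A^T).
have -> : #|shortened C U| = #|(C :&: lker f)%VS|.
  apply: eq_card => X; rewrite inE memv_cap mx_perp_basis_mx memv_ker.
  by rewrite lfunE.
have fC : (f @: C = fullv)%VS.
  (* A nonzero Z orthogonal to a proper image pulls back to the dual word [Z *m A], nonzero because
     the rows of [A] are independent, of rank at most dim U. *)
  apply: contraTeq lt_U_d' => /proper_dual_code[Z Z_neq0 /dual_codeP dZ].
  rewrite -leqNgt; pose Y := Z *m A.
  have dY : Y \in dual_code C.
    apply/dual_codeP => X CX; rewrite trmx_mul mulmxA.
    by have := dZ _ (memv_img f CX); rewrite lfunE.
  have Y_neq0 : Y != 0.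
    apply: contra Z_neq0 => /eqP Y0; apply/eqP.
    by apply: (row_free_inj (row_free_basis_mx U)); rewrite mul0mx.
  apply: leq_trans (min_rank_dist_le dY Y_neq0) _.
  by apply: leq_trans (mxrankM_maxr _ _) _; apply: rank_leq_row.
rewrite card_vspace -expnD; congr (_ ^ _)%N.
by rewrite -(limg_ker_dim f C) fC dimvf /dim.
Qed.

(** The kernel of a nonzero word has dimension at most n - d. *)
Lemma shortened_large (F : finFieldType) m n (C : {vspace 'M[F]_(m, n)})
    (U : {vspace 'rV[F]_n}) :
  (n - min_rank_dist C < \dim U)%N -> #|shortened C U| = 1%N.
Proof.
move=> lt_U; apply/eqP/cards1P; exists 0; apply/setP => X; rewrite !inE.
apply/andP/eqP => [[CX] | ->]; last first.
  by rewrite mem0v mx_perp_basis_mx mul0mx.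
rewrite mx_perp_lker => /dimvS; rewrite dim_lker_mulmxr mxrank_tr => le_U.
apply: contraTeq lt_U => X_neq0; rewrite -leqNgt (leq_trans le_U) //.
by rewrite leq_sub2l // min_rank_dist_le.
Qed.

(** * Binomial moments determine the weight enumerator *)

(** Double counting of pairs of a subspace and a nonzero word vanishing on it; the [- 1] in the
    moment discards the zero word. *)
Lemma binom_momentE (F : finFieldType) m n (C : {vspace 'M[F]_(m, n)}) w :
  binom_moment C w = \sum_(X in C | X != 0)
                       (gauss_binom F (n - \rank X) (n - w))%:R.
Proof.
rewrite /binom_moment.
under eq_bigr => U _.
  rewrite (cardsD1 0) inE mem0v mx_perp_basis_mx mul0mx eqxx natrD addrAC subrr add0r.
  rewrite -sum1_card natr_sum.
  over.
rewrite (exchange_big_dep (fun X => (X \in C) && (X != 0))) /=; last first.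
  by move=> U X _; rewrite !inE => /andP[-> /andP[-> _]].
apply: eq_bigr => X /andP[CX X_neq0]; rewrite -natr_sum; congr _%:R.
rewrite -mxrank_tr -dim_lker_mulmxr -card_subspaces_dim -[RHS]sum1_card.
by apply: eq_bigl => U; rewrite !inE CX X_neq0 /= mx_perp_lker andbC.
Qed.

Lemma weight_enumE (F : finFieldType) m n (C : {vspace 'M[F]_(m, n)}) :
  weight_enum C = \sum_(X in C) xvar ^+ (n - \rank X) * yvar ^+ \rank X.
Proof.
rewrite /weight_enum big_mkord.
rewrite (partition_big (fun X => inord (\rank X) : 'I_n.+1) xpredT) //=.
apply: eq_bigr => t _; rewrite scaler_nat -sumr_const.
apply: congr_big => // X; rewrite ?inE.
  by rewrite -val_eqE /= inordK // ltnS rank_leq_col.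
by case/andP=> _ /eqP->.
Qed.

Lemma weight_enum_phi (F : finFieldType) m n (C : {vspace 'M[F]_(m, n)}) d :
  min_rank_dist C = d ->
  \sum_(u < (n - d).+1) norm_binom_moment C u%:Z *: phi F n (n - d - u)
  = weight_enum C - xvar ^+ n.
Proof.
move=> dC; have le_dn: (d <= n)%N by rewrite -dC min_rank_dist_le_col.
pose f w := (binom_moment C w / (gauss_binom F n w)%:R) *: phi F n (n - w).
transitivity (\sum_(w < n.+1) f w).
  (* Moments with w < d vanish, since kernels of nonzero words have dimension at most n - d < n - w.
     The rest is reindexed by w = u + d. *)
  symmetry; rewrite -(big_mkord xpredT) (big_cat_nat (leq0n d)) ?leqW //=.
  rewrite [X in X + _]big_nat [X in X + _]big1 ?add0r => [|w lt_wd]; last first.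
    rewrite /f binom_momentE big1 ?mul0r ?scale0r // => X /andP[CX X_neq0].
    have := min_rank_dist_le CX X_neq0; rewrite dC => le_dX.
    by rewrite gauss_binom_small //; have := rank_leq_col X; lia.
  rewrite -{1}[d]add0n big_addn big_mkord subSn //; apply: eq_bigr => u _.
  have := ltn_ord u; rewrite ltnS => le_u.
  rewrite /f /norm_binom_moment dC ifT; last lia.
  by congr (_ *: phi F n _); lia.
(* The zero word accounts for x^n; each other word is expanded by [monom_phi]. *)
have memC0: (0 \in C) by apply: mem0v.
rewrite weight_enumE (bigD1 (0 : 'M_(m, n))) //= mxrank0 subn0 expr0 mulr1.
rewrite addrAC subrr add0r.
under eq_bigr => w _ do rewrite /f binom_momentE mulr_suml scaler_suml.
rewrite exchange_big; apply: eq_bigr => X _.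
exact: monom_phi (rank_leq_col X).
Qed.

(** * Closed form of the large moments and degree of the zeta polynomial *)

Lemma exists_subspace_dim (F : finFieldType) n v :
  (v <= n)%N -> exists U : {vspace 'rV[F]_n}, \dim U = v.
Proof.
move/(gauss_binom_gt0 F); rewrite /gauss_binom card_gt0 => /set0Pn[U].
by rewrite inE => /eqP; exists U.
Qed.

(** Shortening at a subspace of dimension v leaves only the zero word, yet it leaves q^(k-mv)
    words. *)
Lemma dim_code_extremal (F : finFieldType) m n (C : {vspace 'M[F]_(m, n)}) v :
  (n - min_rank_dist C < v <= n)%N -> (v < min_rank_dist (dual_code C))%N ->
  \dim C = (m * v)%N.
Proof.
move=> /andP[lt_v /(exists_subspace_dim F)[U dimU]] lt_vd'.
have := @card_shortened_dual F m n C U; rewrite shortened_large dimU // mul1n.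
by move/(_ lt_vd')/eqP; rewrite eqn_exp2l ?card_finField_gt1 // => /eqP.
Qed.

Lemma min_rank_dist_dual_le (F : finFieldType) m n (C : {vspace 'M[F]_(m, n)}) :
  (0 < m)%N -> (min_rank_dist C + min_rank_dist (dual_code C) <= n + 2)%N.
Proof.
move=> m_gt0; have le_d := min_rank_dist_le_col C.
have le_d' := min_rank_dist_le_col (dual_code C).
rewrite leqNgt; apply/negP => gt_dd'.
(* Otherwise dim C would be both m (n - d + 1) and m (n - d + 2). *)
have := @dim_code_extremal F m n C (n - min_rank_dist C).+1.
rewrite (@dim_code_extremal F m n C (n - min_rank_dist C).+2); [|lia..].
by move=> /(_ ltac:(lia) ltac:(lia))/eqP; rewrite eqn_pmul2l // => /eqP; lia.
Qed.

(** All subspaces of dimension n - u - d < d' contribute equally, so dividing by their number gives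
    the common value. The value u = -1 is included because the recurrence for p_u can reach it. *)
Lemma norm_binom_moment_large (F : finFieldType) m n
    (C : {vspace 'M[F]_(m, n)}) (u : int) :
    (0 < n)%N -> -1 <= u ->
    n%:Z - u - (min_rank_dist C)%:Z < (min_rank_dist (dual_code C))%:Z ->
  norm_binom_moment C u
  = #|F|%:R ^ ((\dim C)%:Z - m%:Z * (n%:Z - u - (min_rank_dist C)%:Z)) - 1.
Proof.
move=> n_gt0 u_ge; have q_gt1 := card_finField_gt1 F.
have d_gt0 := min_rank_dist_gt0 C n_gt0.
have le_d := min_rank_dist_le_col C.
set d := min_rank_dist C in d_gt0 le_d *.
have q_neq0: (#|F|%:R : rat) != 0 by rewrite pnatr_eq0 -lt0n ltnW.
case: u u_ge => [u|[|//]] _ lt_d'; rewrite /norm_binom_moment -/d.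
  case: ifP => // le_udn; rewrite /binom_moment.
  rewrite -(gauss_binom_sym F le_udn).
  under eq_bigr => U /eqP dimU.
    have -> : #|shortened C U|%:R
        = #|F|%:R ^ ((\dim C)%:Z - m%:Z * (n%:Z - u%:Z - d%:Z)) :> rat.
      have lt_U: (\dim U < min_rank_dist (dual_code C))%N by rewrite dimU; lia.
      apply: (mulIf (expf_neq0 (m * \dim U) q_neq0)).
      rewrite -natrX -natrM card_shortened_dual // !natrX !exprnP -expfzDr //.
      by congr (_ ^ _); rewrite dimU; nia.
    over.
  rewrite (eq_bigl (fun U : {vspace 'rV[F]_n} =>
      U \in [set U | \dim U == (n - (u + d))%N])) => [|U]; last by rewrite inE.
  rewrite sumr_const -/(gauss_binom F n _) -[_ *+ gauss_binom _ _ _]mulr_natr.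
  by rewrite mulfK // pnatr_eq0 -lt0n gauss_binom_gt0 // leq_subr.
(* u = -1 can only occur for an MRD code, and then both sides vanish. *)
rewrite (@dim_code_extremal F m n C (n - d).+1); [|rewrite -/d; lia..].
have -> : n%:Z - Negz 0 - d%:Z = (n - d).+1%:Z by lia.
by rewrite PoszM subrr expr0z subrr.
Qed.

Local Arguments norm_binom_moment : simpl never.

Lemma zeta_coef_eq0 (F : finFieldType) m n (C : {vspace 'M[F]_(m, n)}) u :
    (0 < m)%N -> (0 < n)%N ->
    (n + 3 <= u + min_rank_dist C + min_rank_dist (dual_code C))%N ->
  zeta_coef C u = 0.
Proof.
move=> m_gt0 n_gt0 le_u; have le_dd' := min_rank_dist_dual_le C m_gt0.
have q_neq0: (#|F|%:R : rat) != 0.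
  by rewrite pnatr_eq0 -lt0n ltnW // card_finField_gt1.
(* As d + d' <= n + 2, the bound on u forces u >= 1, so that u - 2 >= -1 and all three moments have
   the closed form. *)
rewrite /zeta_coef !norm_binom_moment_large //; [|lia..].
set a := (\dim C)%:Z - _.
have -> : (\dim C)%:Z - m%:Z * (n%:Z - (u%:Z - 1) - (min_rank_dist C)%:Z)
          = a - m%:Z by rewrite /a; ring.
have -> : (\dim C)%:Z - m%:Z * (n%:Z - (u%:Z - 2) - (min_rank_dist C)%:Z)
          = a - m%:Z - m%:Z by rewrite /a; ring.
have eqm z : #|F|%:R ^ z = #|F|%:R ^ (z - m%:Z) * (#|F| ^ m)%:R :> rat.
  by rewrite natrX exprnP -expfzDr // subrK.
rewrite [_ ^ a]eqm [_ ^ (a - _)]eqm.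
by move: (_ ^ _ : rat) ((#|F| ^ m)%:R : rat) => x Q; ring.
Qed.

Lemma zeta_polyE (F : finFieldType) m n (C : {vspace 'M[F]_(m, n)}) u :
  (0 < m)%N -> (0 < n)%N -> (zeta_poly C)`_u = zeta_coef C u.
Proof.
move=> m_gt0 n_gt0; rewrite coef_poly; case: ltnP => // le_u.
have le_dd' := min_rank_dist_dual_le C m_gt0.
by rewrite zeta_coef_eq0 //; lia.
Qed.

Lemma expq_sub1_neq0 (F : finFieldType) m :
  (0 < m)%N -> ((#|F| ^ m)%:R - 1 : rat) != 0.
Proof.
move=> m_gt0; rewrite subr_eq0 pnatr_eq1 -(expn0 #|F|) eqn_exp2l.
  by rewrite -lt0n.
exact: card_finField_gt1.
Qed.

(** * Expansion in MRD weight enumerators *)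

(** The sum telescopes: (q^m - 1) p_u = (b_u - q^m b_(u-1)) - (b_(u-1) - q^m b_(u-2)). *)
Lemma zeta_coef_sum (F : finFieldType) m n (C : {vspace 'M[F]_(m, n)}) u :
  (0 < m)%N ->
  ((#|F| ^ m)%:R - 1) * \sum_(i < u.+1) zeta_coef C i
  = norm_binom_moment C u%:Z - (#|F| ^ m)%:R * norm_binom_moment C (u%:Z - 1).
Proof.
move=> m_gt0; have q_neq0 := expq_sub1_neq0 F m_gt0.
elim: u => [|u IHu].
  rewrite big_ord1 /zeta_coef mulrA mulfV // mul1r !sub0r.
  have -> : norm_binom_moment C (- 1) = 0 by [].
  by have -> : norm_binom_moment C (- 2) = 0 by []; ring.
rewrite big_ord_recr mulrDr /= {}IHu /zeta_coef mulrA mulfV // mul1r.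
have -> : u.+1%:Z - 1 = u%:Z by lia.
have -> : u.+1%:Z - 2 = u%:Z - 1 by lia.
by ring.
Qed.

(** The weights are, up to the factor q^m - 1, the coefficients of 1/((1-T)(1-q^m T)). *)
Lemma zeta_coef_sum_geom (F : finFieldType) m n (C : {vspace 'M[F]_(m, n)}) u :
  (0 < m)%N ->
  \sum_(i < u.+1) zeta_coef C i * ((#|F| ^ m)%:R ^+ (u - i).+1 - 1)
  = norm_binom_moment C u%:Z.
Proof.
move=> m_gt0; set Q := (#|F| ^ m)%:R.
elim: u => [|u IHu].
  have := zeta_coef_sum C 0 m_gt0; rewrite !big_ord1 subn0 expr1 mulrC => ->.
  by rewrite sub0r (_ : norm_binom_moment C (- 1) = 0) // mulr0 subr0.
(* This uses Q^(j+1) - 1 = Q (Q^j - 1) + (Q - 1) in each term. *)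
transitivity (Q * \sum_(i < u.+1) zeta_coef C i * (Q ^+ (u - i).+1 - 1)
              + (Q - 1) * \sum_(i < u.+2) zeta_coef C i).
  rewrite [LHS]big_ord_recr [X in _ = _ + _ * X]big_ord_recr /= subnn expr1.
  rewrite (mulrDr (Q - 1)) addrA [_ * (Q - 1)]mulrC; congr (_ + _).
  rewrite !mulr_sumr -big_split /=; apply: eq_bigr => i _.
  by rewrite subSn -1?ltnS // exprS; ring.
rewrite IHu zeta_coef_sum //; have -> : u.+1%:Z - 1 = u%:Z by lia.
by rewrite -/Q; ring.
Qed.

(** With d' >= 2 the closed form reaches down to u = n - d - 1, and (q^k - 1) - q^m (q^(k-m) - 1) =
    q^m - 1. *)
Lemma zeta_coef_sum1 (F : finFieldType) m n (C : {vspace 'M[F]_(m, n)}) d :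
    (0 < m)%N -> (0 < n)%N ->
    min_rank_dist C = d -> (2 <= min_rank_dist (dual_code C))%N ->
  \sum_(i < (n - d).+1) zeta_coef C i = 1.
Proof.
move=> m_gt0 n_gt0 dC le2d'; have q_neq0 := expq_sub1_neq0 F m_gt0.
have le_d := min_rank_dist_le_col C.
apply: (mulfI q_neq0); rewrite zeta_coef_sum // !norm_binom_moment_large //; [|lia..].
rewrite dC natrX.
have -> : n%:Z - (n - d)%N%:Z - d%:Z = 0 by lia.
have -> : n%:Z - ((n - d)%N%:Z - 1) - d%:Z = 1 by lia.
rewrite mulr0 mulr1 subr0.
have -> : (\dim C)%:Z = ((\dim C)%:Z - m%:Z) + m%:Z by ring.
rewrite addrK expfzDr; last by rewrite pnatr_eq0 -lt0n ltnW // card_finField_gt1.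
by rewrite -exprnP; ring.
Qed.

(** Exchanging the double sum of [mrd_enum] collects a phi polynomial for each inner index w = u +
    d. *)
Lemma mrd_enum_phi (F : finFieldType) m n d i :
  (d + i <= n)%N ->
  mrd_enum F m n (d + i) = xvar ^+ n + \sum_(u < (n - d).+1 | (i <= u)%N)
    ((#|F| ^ m)%:R ^+ (u - i).+1 - 1) *: phi F n (n - d - u).
Proof.
move=> le_din; rewrite /mrd_enum; congr (_ + _).
pose f w := ((#|F| ^ m)%:R ^+ (w - (d + i) + 1) - 1) *: phi F n (n - w).
transitivity (\sum_(d + i <= w < n.+1) f w); last first.
  rewrite addnC big_addn subSn ?big_geq_mkord; last lia.
  apply: eq_bigr => u _; rewrite /f.
  have -> : (u + d - (d + i) + 1 = (u - i).+1)%N by lia.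
  by have -> : (n - (u + d) = n - d - u)%N by lia.
under [RHS]eq_big_nat => w /andP[_ lt_wn].
  rewrite /f phiE // scaler_sumr.
  over.
rewrite exchange_big big_geq_mkord big_mkcond; apply: eq_bigr => t _ /=.
(* The extra terms all have w > t, hence [t; w] = 0. *)
case: leqP => [le_t|lt_t]; last first.
  rewrite big_nat big1 // => w /andP[le_w _].
  by rewrite [gauss_binom F t w]gauss_binom_small ?mulr0 ?scale0r ?scaler0 //; lia.
have lt_tn := ltn_ord t.
rewrite [RHS](big_cat_nat (leqW le_t)) //= [X in _ + X]big_nat.
rewrite [X in _ + X]big1 ?addr0 => [|w /andP[lt_tw _]]; last first.
  by rewrite [gauss_binom F t w]gauss_binom_small ?mulr0 ?scale0r ?scaler0.
apply: eq_bigr => w _; rewrite scalerA expnM (natrX _ (#|F| ^ m)%N).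
by rewrite mulrC.
Qed.

(** On the right x^n has total coefficient P(1) = 1, and [zeta_coef_sum_geom] identifies the
    coefficient of each phi polynomial as b_u. *)
Lemma weight_enum_mrd (F : finFieldType) m n (C : {vspace 'M[F]_(m, n)}) d :
    (0 < m)%N -> (0 < n)%N ->
    min_rank_dist C = d -> (2 <= min_rank_dist (dual_code C))%N ->
  weight_enum C = \sum_(i < (n - d).+1) zeta_coef C i *: mrd_enum F m n (d + i).
Proof.
move=> m_gt0 n_gt0 dC le2d'.
have le_d : (d <= n)%N by rewrite -dC min_rank_dist_le_col.
under eq_bigr => i _.
  rewrite mrd_enum_phi; last by have := ltn_ord i; lia.
  rewrite scalerDr scaler_sumr.
  over.
rewrite big_split /= -scaler_suml zeta_coef_sum1 // scale1r.
rewrite (exchange_big_dep xpredT) //=.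
apply: (addrI (- xvar ^+ n)); rewrite addKr addrC -(weight_enum_phi dC).
apply: eq_bigr => u _; under [RHS]eq_bigr => i _ do rewrite scalerA.
rewrite -scaler_suml; congr (_ *: _).
by rewrite -zeta_coef_sum_geom // (big_ord_widen (n - d).+1
  (fun i => zeta_coef C i * ((#|F| ^ m)%:R ^+ (u - i).+1 - 1))) //.
Qed.

(** * Linear independence of the MRD enumerators *)

Definition xymnm n t : 'X_{1..2} :=
  [multinom (if (i : nat) == 0 then n - t else t)%N | i < 2].

Lemma mcoeff_monom n s t :
  (xvar ^+ (n - s) * yvar ^+ s)@_(xymnm n t) = (s == t)%:R.
Proof.
have -> : xvar ^+ (n - s) * yvar ^+ s = 'X_[xymnm n s].
  by rewrite mpolyXE_id !big_ord_recl big_ord0 !mnmE mulr1.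
rewrite mcoeffX; congr (_%:R); congr nat_of_bool.
(* The exponent of y, at index 1, already determines t. *)
apply/eqP/eqP => [/mnmP/(_ 1)|->//]; by rewrite !mnmE.
Qed.

(** Beyond x^n, the lowest power of y present is y^delta, and only t = i = delta contributes to
    it. *)
Lemma mcoeff_mrd_enum (F : finFieldType) m n delta t :
    (0 < t <= delta)%N -> (delta <= n)%N ->
  (mrd_enum F m n delta)@_(xymnm n t)
  = (t == delta)%:R * (gauss_binom F n delta)%:R * ((#|F| ^ m)%:R - 1).
Proof.
move=> /andP[t_gt0 le_t] le_n; rewrite /mrd_enum mcoeffD.
have := mcoeff_monom n 0 t; rewrite subn0 expr0 mulr1 => ->.
rewrite [0%N == t]ltn_eqF // add0r raddf_sum /=.
under eq_bigr => s _ do rewrite -scaler_suml mcoeffZ mcoeff_monom.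
rewrite big_ltn ?ltnS //.
rewrite big_nat1 subnn expr0 bin0n expn0 add0n muln1.
rewrite gauss_binom_full big_nat big1 ?addr0; last first.
  by move=> s /andP[lt_s _]; rewrite [_ == _]gtn_eqF ?mulr0 // (leq_ltn_trans le_t).
by rewrite eq_sym; ring.
Qed.

(** Comparing coefficients of y^(d+j): terms with i < j vanish by induction, those with i > j start
    at a higher power of y, and the diagonal coefficient is nonzero. *)
Lemma mrd_enum_free (F : finFieldType) m n d (c : nat -> rat) :
    (0 < m)%N -> (0 < d <= n)%N ->
    \sum_(i < (n - d).+1) c i *: mrd_enum F m n (d + i) = 0 ->
  forall j, (j <= n - d)%N -> c j = 0.
Proof.
move=> m_gt0 /andP[d_gt0 le_d] sum0 j.
elim/ltn_ind: j => j IHj le_j.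
have /(congr1 (mcoeff (xymnm n (d + j)))) := sum0.
rewrite mcoeff0 raddf_sum /= (bigD1 (Ordinal (le_j : (j < (n - d).+1)%N))) //=.
rewrite big1 ?addr0 => [|i]; last first.
  rewrite -val_eqE /= mcoeffZ; case: ltngtP => // [lt_ij|lt_ji] _.
    by rewrite IHj ?mul0r // (leq_trans (ltnW lt_ij)).
  have := ltn_ord i; rewrite ltnS => le_i.
  rewrite mcoeff_mrd_enum; [|lia..].
  by rewrite eqn_add2l ltn_eqF // !mul0r mulr0.
rewrite mcoeffZ mcoeff_mrd_enum; [|lia..].
rewrite eqxx mul1r => /eqP; rewrite !mulf_eq0 (negPf (expq_sub1_neq0 F m_gt0)).
have g_gt0: (0 < gauss_binom F n (d + j))%N by rewrite gauss_binom_gt0; lia.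
by rewrite pnatr_eq0 eqn0Ngt g_gt0 !orbF => /eqP.
Qed.

(** * Power series algebra and the zeta function as a quotient *)

Lemma eq_fps_mul (R : comUnitRingType) (f f' g g' : fps R) :
  f =1 f' -> g =1 g' -> fps_mul f g =1 fps_mul f' g'.
Proof. by move=> ef eg k; apply: eq_bigr => i _; rewrite ef eg. Qed.

(** Truncation to polynomials transfers commutativity and associativity to series. *)
Lemma fps_mul_poly (R : comUnitRingType) N (f g : fps R) k : (k < N)%N ->
  fps_mul f g k = (\poly_(i < N) f i * \poly_(i < N) g i)`_k.
Proof.
move=> lt_kN; rewrite coefM; apply: eq_bigr => i _; have := ltn_ord i.
by rewrite ltnS => le_ik; rewrite !coef_poly !ifT //; lia.
Qed.

Lemma fps_mulC (R : comUnitRingType) (f g : fps R) : fps_mul f g =1 fps_mul g f.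
Proof. by move=> k; rewrite !(@fps_mul_poly _ k.+1) // mulrC. Qed.

Lemma fps_mulA (R : comUnitRingType) (f g h : fps R) :
  fps_mul f (fps_mul g h) =1 fps_mul (fps_mul f g) h.
Proof.
move=> k; pose T (u : fps R) := \poly_(i < k.+1) u i.
have coefT u v i : (i <= k)%N -> fps_mul u v i = (T u * T v)`_i.
  by move=> le_ik; rewrite (@fps_mul_poly _ k.+1).
transitivity (T f * (T g * T h))`_k.
  rewrite coefM; apply: eq_bigr => i _; have := ltn_ord i; rewrite ltnS => le_ik.
  by rewrite coef_poly ltnS le_ik coefT // leq_subr.
rewrite mulrA coefM; apply: eq_bigr => i _; have := ltn_ord i; rewrite ltnS => le_ik.
by rewrite [(T h)`__]coef_poly ltnS leq_subr coefT.
Qed.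

Lemma fps_mul1 (R : comUnitRingType) (f : fps R) :
  fps_mul f (fps_of_poly 1) =1 f.
Proof.
move=> k; rewrite /fps_mul big_ord_recr /= subnn /fps_of_poly coef1 mulr1.
rewrite big1 ?add0r // => i _; rewrite coef1 subn_eq0 leqNgt ltn_ord.
by rewrite mulr0.
Qed.

Lemma fps_of_polyM (R : comUnitRingType) (p r : {poly R}) :
  fps_of_poly (p * r) =1 fps_mul (fps_of_poly p) (fps_of_poly r).
Proof. by move=> k; rewrite /fps_of_poly coefM. Qed.

Lemma fps_divP (R : comUnitRingType) (f g h : fps R) :
  g 0%N \is a GRing.unit -> fps_mul h g =1 f -> h =1 fps_div f g.
Proof.
move=> Ug hg k; rewrite /fps_div -(eq_fps_mul hg (fun=> erefl)) -fps_mulA.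
by rewrite (eq_fps_mul (fun=> erefl) (fps_mulV Ug)) fps_mul1.
Qed.

(** The recurrence defining p_u is multiplication by 1 - (1 + q^m) T + q^m T^2. *)
Lemma zeta_series_denom (F : finFieldType) m n (C : {vspace 'M[F]_(m, n)}) :
  (0 < m)%N -> (0 < n)%N ->
  fps_mul (fun u => (zeta_series C u)%:MP) (fps_of_poly (zeta_denom F m))
  =1 fps_of_poly (map_poly (@mpolyC 2 rat) (zeta_poly C)).
Proof.
move=> m_gt0 n_gt0 k; rewrite fps_mulC /fps_of_poly coef_map /= zeta_polyE //.
set Z := fun u => (zeta_series C u)%:MP.
set c := (#|F| ^ m)%:R : {mpoly rat[2]}.
pose z := \poly_(i < k.+1) Z i.
have -> : fps_mul (fun i => (zeta_denom F m)`_i) Z k = (zeta_denom F m * z)`_k.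
  rewrite coefM; apply: eq_bigr => i _; rewrite coef_poly ifT //.
  by rewrite ltnS leq_subr.
have -> : zeta_denom F m * z = z - (1 + c) *: ('X * z) + c *: ('X * ('X * z)).
  by rewrite /zeta_denom -/c -!mul_polyC polyCD polyC1; ring.
rewrite coefD coefB !coefZ !coefXM.
have cE : c = ((#|F| ^ m)%:R : rat)%:MP by rewrite /c -mpolyC_nat.
have zE i : (i <= k)%N -> z`_i = (zeta_series C i)%:MP.
  by move=> le_ik; rewrite coef_poly ltnS le_ik.
rewrite cE -[1](mpolyC1 2 rat) -mpolyCD /zeta_coef.
(* For k = 0 and k = 1 the missing terms of the product match the convention b_(-1) = b_(-2) = 0. *)
clearbody z; case: k z zE => [|[|k]] z zE /=;
  rewrite !zE ?(leqW (leqnSn _)) // ?mulr0 ?addr0 ?subr0 //.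
  rewrite -mpolyCM -mpolyCB; congr _%:MP; rewrite /zeta_series.
  by have -> : 1%:Z - 1 = 0%N%:Z by []; ring.
rewrite -!mpolyCM -mpolyCB -mpolyCD; congr _%:MP; rewrite /zeta_series.
have -> : k.+2%:Z - 1 = k.+1%:Z by lia.
have -> : k.+2%:Z - 2 = k%:Z by lia.
by ring.
Qed.

Lemma zeta_denom0 (F : finFieldType) m :
  fps_of_poly (zeta_denom F m) 0%N \is a GRing.unit.
Proof.
rewrite /fps_of_poly /zeta_denom coefM big_ord1 subn0.
by rewrite !coefB !coef1 coefZ !coefX mulr0 subr0 mulr1 unitr1.
Qed.

Lemma zeta_series_phi (F : finFieldType) m n (C : {vspace 'M[F]_(m, n)}) d :
  min_rank_dist C = d ->
  fps_mul (fun u => (zeta_series C u)%:MP) (fps_of_poly (phi_poly F n)) (n - d)%N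
  = ((#|F| ^ m)%:R - 1)^-1 *: (weight_enum C - xvar ^+ n).
Proof.
move=> dC; rewrite -(weight_enum_phi dC) scaler_sumr; apply: eq_bigr => u _.
rewrite /fps_of_poly coef_poly ifT; last first.
  by rewrite ltnS -subnDA leq_subr.
by rewrite mul_mpolyC scalerA.
Qed.

Theorem theorem4p7 (F : finFieldType) (m n : nat)
    (C : {vspace 'M[F]_(m, n)}) (d : nat)
    (m_gt0 : (0 < m)%N) (n_gt0 : (0 < n)%N) (le_nm : (n <= m)%N)
    (C_neq0 : C != 0%VS) (dC : min_rank_dist C = d)
    (C'_neq0 : dual_code C != 0%VS)
    (dC' : (2 <= min_rank_dist (dual_code C))%N) :
  let qm : rat := (#|F| ^ m)%:R in
  let Zphi : fps {mpoly rat[2]} :=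
    fps_mul (fun u => (zeta_series C u)%:MP) (fps_of_poly (phi_poly F n)) in
  let P := zeta_poly C in
  [/\ Zphi =1 fps_div (fps_of_poly (map_poly (@mpolyC 2 rat) P * phi_poly F n))
                      (fps_of_poly (zeta_denom F m)),
      Zphi (n - d)%N = (qm - 1)^-1 *: (weight_enum C - xvar ^+ n),
      P = \poly_(i < (n - d).+1) zeta_coef C i,
      weight_enum C = \sum_(i < (n - d).+1) P`_i *: mrd_enum F m n (d + i)
    & forall Q : {poly rat}, (size Q <= (n - d).+1)%N ->
        weight_enum C = \sum_(i < (n - d).+1) Q`_i *: mrd_enum F m n (d + i) ->
        Q = P].
Proof.
move=> qm Zphi P.
have le_d : (d <= n)%N by rewrite -dC min_rank_dist_le_col.
have d_gt0 : (0 < d)%N by rewrite -dC min_rank_dist_gt0.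
(* As d' >= 2, the degree bound n - d - d' + 2 is at most n - d. *)
have PE : P = \poly_(i < (n - d).+1) zeta_coef C i.
  apply/polyP => i; rewrite zeta_polyE // coef_poly; case: ltnP => // lt_i.
  by rewrite zeta_coef_eq0 // dC; lia.
have WP : weight_enum C = \sum_(i < (n - d).+1) P`_i *: mrd_enum F m n (d + i).
  under eq_bigr => i _ do rewrite zeta_polyE //.
  exact: weight_enum_mrd.
split; [| |exact: PE|exact: WP|].
- apply: fps_divP (zeta_denom0 F m) _ => k.
  rewrite -fps_mulA (eq_fps_mul (fun=> erefl) (fps_mulC _ _)) fps_mulA.
  by rewrite (eq_fps_mul (zeta_series_denom C m_gt0 n_gt0) (fun=> erefl)) fps_of_polyM.
- exact: zeta_series_phi.
move=> Q leQ WQ; apply/polyP => i; have [lt_i|le_i] := ltnP i (n - d).+1.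
  apply/eqP; rewrite -subr_eq0; apply/eqP; move: i lt_i.
  (* Subtracting the two expansions gives a vanishing combination with coefficients those of Q -
     P. *)
  apply: (@mrd_enum_free F m n d (fun i => Q`_i - P`_i)) => //; first exact/andP.
  under eq_bigr => i _ do rewrite scalerBl.
  by rewrite sumrB -WQ -WP subrr.
by rewrite !nth_default ?(leq_trans leQ) // PE (leq_trans (size_poly _ _)).
Qed.
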